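(* Fix an integer $d\ge 2$. Let $\Phi(n,d)$ be the number of 1-factorizations of the complete $d$-uniform hypergraph $G^d_n$ on $n$ vertices, and let $\mu(n,2)=1$, $\mu(n,3)=\left(\frac{2^{3/2}}{3}\right)^n$, and $\mu(n,d)=\left(\frac{d!^{2}}{d^{d}\, d!^{1/d}}\right)^n$ for $d\ge 4$. Then, as $n\to\infty$ through multiples of $d$, $$\Phi(n,d) \leq \left((1+o(1))\frac{ n^{d-1}}{\mu(n,d)^{1/n}\, e^d} \right)^{\frac{n^d}{d!}}.$$
   Context: The complete $d$-uniform hypergraph $G^d_n$ has $n$ vertices, and its hyperedges are all $d$-element subsets of the vertex set. A 1-factor of a hypergraph is a set of hyperedges such that every vertex is incident to exactly one hyperedge of the set. A 1-factorization is an ordered partition of all hyperedges into disjoint 1-factors (for $G^d_n$ it consists of $\binom{n-1}{d-1}$ 1-factors). The $o(1)$ term denotes a quantity depending on $n$ (and on the fixed $d$) that tends to $0$ as $n\to\infty$. *)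

(* Defs.v *)
From mathcomp Require Import all_boot all_order all_algebra.
Set Implicit Arguments.
Unset Strict Implicit.
Unset Printing Implicit Defensive.
Import Order.TTheory GRing.Theory Num.Theory.

Definition hyperedges (n d : nat) : {set {set 'I_n}} :=
  [set e : {set 'I_n} | #|e| == d].

Definition one_factor (n d : nat) (F : {set {set 'I_n}}) : bool :=
  (F \subset hyperedges n d) &&
  [forall v : 'I_n, #|[set e in F | v \in e]| == 1].

Definition one_factorization (n d : nat) (s : seq {set {set 'I_n}}) : bool :=
  [&& uniq s, all (one_factor d) s
    & partition [set F in s] (hyperedges n d)].

(* [size_one_factorization] below shows that, for [0 < n] and [0 < d], fixing
   the number of 1-factors to be 'C(n.-1, d.-1) loses no 1-factorization. *)
Definition Phi (n d : nat) : nat :=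
  #|[set s : ('C(n.-1, d.-1)).-tuple {set {set 'I_n}}
      | one_factorization d s]|.

Lemma size_one_factorization (n d : nat) (s : seq {set {set 'I_n}}) :
  0 < n -> 0 < d -> one_factorization d s -> size s = 'C(n.-1, d.-1).
Proof.
case: n s => // n s _; case: d => // d _.
rewrite /one_factorization => /and3P[us /allP fs ps] /=.
pose star : {set {set 'I_n.+1}} :=
  [set e in hyperedges n.+1 d.+1 | ord0 \in e].
have cstar : #|star| = 'C(n, d).
  have -> : star = [set (ord0 |: A)
      | A in [set A : {set 'I_n.+1} | A \subset [set~ ord0] & #|A| == d]].
    apply/setP => e; rewrite !inE; apply/andP/imsetP => [[ce e0]|[A]].
      exists (e :\ ord0); last by rewrite setD1K.
      rewrite inE; apply/andP; split; last first.
        by rewrite (cardsD1 ord0 e) e0 add1n eqSS in ce.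
      by apply/subsetP => x; rewrite !inE => /andP[].
    rewrite inE => /andP[/subsetP sA cA] ->; split; last by rewrite setU11.
    rewrite cardsU1 (eqP cA).
    suff /negPf -> : ord0 \notin A by [].
    by apply/negP => /sA; rewrite !inE eqxx.
  rewrite card_in_imset.
    by rewrite cards_draws cardsC1 card_ord.
  move=> A B; rewrite !inE => /andP[/subsetP sA _] /andP[/subsetP sB _] AB.
  have nA : ord0 \notin A by apply/negP => /sA; rewrite !inE eqxx.
  have nB : ord0 \notin B by apply/negP => /sB; rewrite !inE eqxx.
  by rewrite -(setU1K nA) AB setU1K.
rewrite -cstar.
have <- : #|[set F in s]| = size s by rewrite cardsE; apply/card_uniqP.
have -> : #|star| = \sum_(e in hyperedges n.+1 d.+1) (ord0 \in e).
  by rewrite -sum1_card big_mkcond [RHS]big_mkcond /=; apply: eq_bigr => e _;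
     rewrite inE; case: (e \in _); case: (_ \in e).
case/and3P: ps => /eqP <- tI _.
rewrite big_trivIset //= -sum1_card; apply: eq_bigr => F.
rewrite inE => /fs /andP[_ /forallP/(_ ord0)/eqP <-].
by rewrite -sum1_card big_mkcond [RHS]big_mkcond /=; apply: eq_bigr => e _;
   rewrite inE; case: (e \in _); case: (_ \in e).
Qed.

From mathcomp Require Import all_classical all_reals all_analysis.

Local Open Scope ring_scope.

Definition mu (R : realType) (n d : nat) : R :=
  if d == 2%N then 1
  else if d == 3%N then (2 `^ (3 / 2) / 3) ^+ n
  else (d`!%:R ^+ 2 / (d%:R ^+ d * d`!%:R `^ (1 / d%:R))) ^+ n.

(* Main.v *)
Require Import Defs.
From mathcomp Require Import all_boot all_order all_algebra.
From mathcomp Require Import all_classical all_reals all_analysis.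
From mathcomp Require Import ring lra.
From mathcomp Require Import fintype finset.
Import Order.TTheory GRing.Theory Num.Theory.
Import numFieldNormedType.Exports.

(** The proof is an entropy argument with a random exposure order. Write
    [M = 'C(n - 1, d - 1)] for the number of factors, and regard a
    1-factorization as a colouring of the edges with [M] colours, edges of the
    same colour being disjoint.

    Expose the colours of the edges one at a time in some order. If [N f e] is
    the number of colours still possible for [e] when it is reached while
    exposing the colouring [f], then [ln Phi] is at most the average over [f] of
    the sum over [e] of [ln (N f e)] ([card_mul_ln_le_choices]).

    Choose the order by independent uniform labels in [{0, ..., K - 1}]. Almost
    every colour has exactly [d] edges meeting [e], and it is still possible for
    [e] only if all of them come after [e]; given that [e] has label [k], this
    has probability about [x ^ d] with [x = (K - k) / K]. The exceptional
    colours, with an edge covering two vertices of [e], number only [O(M / n)].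
    So [N f e] is on average about [M * x ^ d] ([sum_choices_le]), and by
    concavity the average of its logarithm is about [ln M + d * avg (ln x)].
    The average of [ln x] is [ln (K!) / K - ln K], which tends to [-1]. Hence
    ([ln_Phi_le])
<<
      Phi <= ((1 + o(1)) * M / e ^ d) ^ 'C(n, d).
>>
    Since [M <= n ^ (d - 1) / (d - 1)!], the claim follows once the [n]-th root
    of [mu n d] is known to be at most [(d - 1)!] ([root_mu]). *)

(** * Entropy of sequential exposure *)

Local Open Scope ring_scope.

(** Reveal an unknown element [f] of [A] by exposing its values along [s], and
    at each step guess the next value uniformly among those still compatible
    with what was seen. The product below is at most the probability of
    guessing [f] throughout, and these are disjoint events. [N] is allowed to
    overestimate the number of compatible values, because only an upper bound
    on it is available in applications. *)
Lemma sum_inv_choices_le1 (R : realType) (T C : finType) (E : eqType)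
    (val : T -> E -> C) (N : T -> E -> nat) (s : seq E) (A : {set T}) :
    {in A &, forall f g, {in s, val f =1 val g} -> f = g} ->
    (forall f p e q, f \in A -> s = p ++ e :: q ->
      (#|[set val g e | g in A & all (fun x => val g x == val f x) p]|
        <= N f e)%N) ->
  \sum_(f in A) \prod_(e <- s) (N f e)%:R^-1 <= 1 :> R.
Proof.
elim: s A => [|e s IHs] A inj leN.
  have A1 : (#|A| <= 1)%N by apply/card_le1_eqP => f g fA gA; exact: inj.
  rewrite (eq_bigr (fun=> 1)) => [|f _]; last by rewrite big_nil.
  by rewrite sumr_const lern1.
(* Condition on the first exposed value; each value in B has weight 1 / #|B|. *)
pose B := [set val g e | g in A].
rewrite (partition_big (val^~ e) (mem B)) /=; last first.
  by move=> f fA; rewrite imset_f.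
have [B0|[c0 c0B]] := set_0Vmem B.
  by rewrite B0 big1 // => c; rewrite inE.
have B_gt0 : (0 < #|B|%:R :> R) by rewrite ltr0n card_gt0; apply/set0Pn; exists c0.
apply: (@le_trans _ _ (\sum_(c in B) #|B|%:R^-1)); last first.
  by rewrite sumr_const -[_ *+ _]mulr_natr mulVf // gt_eqF.
apply: ler_sum => c cB.
pose Ac := [set f in A | val f e == c].
have IH : \sum_(f in Ac) \prod_(x <- s) (N f x)%:R^-1 <= 1 :> R.
  apply: IHs => [f g|f p x q].
    rewrite !inE => /andP[fA /eqP fc] /andP[gA /eqP gc] fg.
    apply: inj => // x; rewrite inE => /predU1P[->|/fg//].
    by rewrite fc gc.
  rewrite inE => /andP[fA /eqP fc] sE.
  apply: leq_trans (leN f (e :: p) x q fA _); last by rewrite sE.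
  apply/subset_leq_card/subsetP => y /imsetP[g].
  rewrite !inE => /andP[/andP[gA /eqP gc] gp] ->.
  by apply: imset_f; rewrite inE gA /= gc fc eqxx.
rewrite -[leRHS]mulr1.
apply: le_trans (ler_wpM2l (ltW _) IH); last by rewrite invr_gt0.
rewrite mulr_sumr [leRHS](eq_bigl (fun f => (f \in A) && (val f e == c)));
  last by move=> f; rewrite inE.
apply: ler_sum => f /andP[fA _]; rewrite big_cons.
have BN : (#|B| <= N f e)%N.
  apply: leq_trans (leN f [::] e s fA erefl).
  by apply/subset_leq_card/subsetP => y /imsetP[g gA ->]; apply: imset_f; rewrite inE gA.
apply: ler_wpM2r; first by apply: prodr_ge0 => x _; rewrite invr_ge0.
rewrite lef_pV2 ?posrE ?ler_nat //.
by apply: lt_le_trans B_gt0 _; rewrite ler_nat.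
Qed.

(** The concavity of [ln], in the only form used: replacing [ln x] by a tangent
    makes expectations of logarithms computable from expectations. *)
Lemma ln_le_tangent (R : realType) (a x : R) :
  0 < a -> 0 < x -> ln x <= ln a + x / a - 1.
Proof.
move=> a0 x0; have xa : 0 < x / a by rewrite divr_gt0.
rewrite -{1}(divfK (lt0r_neq0 a0) x) lnM ?posrE // addrC -addrA lerD2l.
have := @le_ln1Dx R (x / a - 1); rewrite subrKC; apply.
by rewrite ltrBrDl subrr.
Qed.

(** Gibbs' inequality against the uniform distribution: by concavity, a
    subprobability on [A] has average logarithm at most [- ln #|A|]. *)
Lemma card_mul_ln_le (R : realType) (T : finType) (A : {set T}) (w : T -> R) :
    {in A, forall f, 0 < w f} -> \sum_(f in A) w f <= 1 ->
  #|A|%:R * ln #|A|%:R <= - \sum_(f in A) ln (w f).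
Proof.
move=> w0 w1; have [A0|[f0 f0A]] := set_0Vmem A.
  by rewrite A0 cards0 mul0r big1 ?oppr0 // => f; rewrite inE.
have A_gt0 : (0 < #|A|%:R :> R) by rewrite ltr0n card_gt0; apply/set0Pn; exists f0.
have iA_gt0 : (0 < #|A|%:R^-1 :> R) by rewrite invr_gt0.
rewrite lerNr.
apply: (@le_trans _ _ (\sum_(f in A) (ln #|A|%:R^-1 + w f / #|A|%:R^-1 - 1))).
  by apply: ler_sum => f fA; apply: ln_le_tangent => //; apply: w0.
rewrite !big_split /= !sumr_const lnV ?posrE // -mulr_suml invrK.
rewrite -[(- ln _) *+ _]mulr_natl -[(- 1) *+ _]mulr_natl mulrN mulrN1.
by rewrite -addrA gerDl subr_le0 ler_piMl // ler0n.
Qed.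

(** The chain rule for the entropy of a uniformly chosen element of [A], with
    each conditional entropy bounded by the logarithm of a support size. *)
Lemma card_mul_ln_le_choices (R : realType) (T C : finType) (E : eqType)
    (val : T -> E -> C) (N : T -> E -> nat) (s : seq E) (A : {set T}) :
    {in A &, forall f g, {in s, val f =1 val g} -> f = g} ->
    (forall f p e q, f \in A -> s = p ++ e :: q ->
      (#|[set val g e | g in A & all (fun x => val g x == val f x) p]|
        <= N f e)%N) ->
  #|A|%:R * ln #|A|%:R <= \sum_(f in A) \sum_(e <- s) ln (N f e)%:R :> R.
Proof.
move=> inj leN.
have N_gt0 f e : f \in A -> e \in s -> (0 < N f e)%N.
  move=> fA /splitPr sE; case: sE leN => p q leN.
  apply: leq_trans (leN f p e q fA erefl); rewrite card_gt0; apply/set0Pn.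
  exists (val f e); apply: imset_f; rewrite inE fA.
  exact/allP.
have /card_mul_ln_le : {in A, forall f, 0 < \prod_(e <- s) (N f e)%:R^-1 :> R}.
  move=> f fA; rewrite big_seq; apply: prodr_gt0 => e es.
  by rewrite invr_gt0 ltr0n N_gt0.
move=> /(_ (sum_inv_choices_le1 R T C E val N s A inj leN)) /le_trans; apply.
rewrite -sumrN; apply: ler_sum => f fA.
move: (N_gt0 f ^~ fA); elim: s {inj leN N_gt0} => [|e s IHs] N_gt0.
  by rewrite !big_nil ln1 oppr0.
have Ne : (0 < (N f e)%:R :> R) by rewrite ltr0n N_gt0 ?mem_head.
have Ns x : x \in s -> (0 < N f x)%N by move=> xs; apply: N_gt0; rewrite inE xs orbT.
rewrite !big_cons lnM ?posrE ?invr_gt0 //; last first.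
  by rewrite big_seq; apply: prodr_gt0 => x xs; rewrite invr_gt0 ltr0n Ns.
by rewrite lnV ?posrE // opprD opprK lerD2l IHs.
Qed.

(** * Counting subsets and labellings *)

Local Open Scope nat_scope.

(** Complementation turns supersets of [B] into subsets of [~: B], which
    [cards_draws] counts. *)
Lemma card_subset_of_size (T : finType) (B : {set T}) (d : nat) :
    #|B| <= d <= #|T| ->
  #|[set x : {set T} | B \subset x & #|x| == d]| = 'C(#|T| - #|B|, d - #|B|).
Proof.
case/andP=> Bd dT.
have -> : [set x : {set T} | B \subset x & #|x| == d]
    = @setC T @: [set y : {set T} | y \subset ~: B & #|y| == #|T| - d].
  apply/setP => x; rewrite !inE; apply/andP/imsetP => [[Bx /eqP xd]|[y]].
    exists (~: x); last by rewrite setCK.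
    by rewrite inE setCS Bx cardsCs setCK xd eqxx.
  rewrite inE => /andP[yB /eqP cy] ->.
  by rewrite -setCS setCK yB cardsCs setCK cy subKn ?eqxx.
rewrite card_imset; last exact: setC_inj.
rewrite cards_draws cardsCs setCK -[RHS]bin_sub ?leq_sub2r //.
by rewrite subnBA // subnK // (leq_trans Bd).
Qed.

(** Union bound over the pairs contained in [e]. *)
Lemma card_meet_twice (T : finType) (e : {set T}) (d : nat) :
    2 <= d <= #|T| ->
  #|[set x : {set T} | #|x| == d & 1 < #|x :&: e|]|
    <= 'C(#|e|, 2) * 'C(#|T| - 2, d - 2).
Proof.
move=> d2T.
pose P := [set B : {set T} | B \subset e & #|B| == 2].
have -> : 'C(#|e|, 2) * 'C(#|T| - 2, d - 2)
    = \sum_(B in P) \sum_(x : {set T} | (B \subset x) && (#|x| == d)) 1.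
  rewrite -cards_draws -sum_nat_const; apply: eq_bigr => B.
  rewrite inE => /andP[_ /eqP B2]; rewrite -{1 2}B2 -card_subset_of_size ?B2 //.
  by rewrite -sum1_card; apply: eq_bigl => x; rewrite inE.
rewrite -sum1_card.
rewrite (exchange_big_dep (fun x : {set T} => #|x| == d)) /=; last by move=> B x _ /andP[].
rewrite (eq_bigl (fun x : {set T} => (#|x| == d) && (1 < #|x :&: e|))); last first.
  by move=> x; rewrite inE.
rewrite big_mkcondr /=; apply: leq_sum => x xd; case: ifP => // xe.
rewrite sum1_card; apply/card_gt0P.
have : 0 < #|[set B : {set T} | B \subset x :&: e & #|B| == 2]|.
  by rewrite cards_draws bin_gt0.
rewrite card_gt0 => /set0Pn[B]; rewrite inE subsetI => /andP[/andP[Bx Be] B2].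
by exists B; rewrite unfold_in /= !inE Bx Be B2 xd.
Qed.

(** Under independent uniform labels, the event below has probability
    [K^-1 * ((K - k) / K) ^ #|S|]; denominators are cleared to stay in [nat]. *)
Lemma card_labels (T : finType) (K : nat) (k : 'I_K) (e : T) (S : {set T}) :
    e \notin S ->
  #|[set lam : {ffun T -> 'I_K} | lam e == k & [forall x in S, k <= lam x]]|
      * K ^ #|S|.+1 = K ^ #|T| * (K - k) ^ #|S|.
Proof.
move=> eS.
(* The event is a product event, with the constraint F x on the label of x. *)
pose F x : {pred 'I_K} :=
  if x == e then pred1 k else if x \in S then [pred j : 'I_K | k <= j] else predT.
have cF : #|[pred j : 'I_K | k <= j]| = K - k.
  rewrite -sum1_card -(big_mkord (fun j => k <= j) (fun=> 1)).
  rewrite (big_cat_nat (leq0n k)) ?(ltnW (ltn_ord k)) //=.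
  rewrite big_nat_cond big1 ?add0n => [|j /andP[/andP[_ jk]]]; last first.
    by rewrite leqNgt jk.
  rewrite big_nat_cond (eq_bigl (fun j => (k <= j < K) && true)) => [|j]; last first.
    by case: (k <= j); rewrite ?andbT.
  by rewrite -big_nat_cond sum_nat_const_nat muln1.
have -> : #|[set lam : {ffun T -> 'I_K} | lam e == k & [forall x in S, k <= lam x]]|
    = \prod_x #|F x|.
  rewrite -(big_image _ _ _ _ (fun m => m)) /= -foldrE -card_family.
  apply: eq_card => lam; rewrite !inE.
  apply/andP/familyP => [[ek /forall_inP Sk] x|lamF].
    rewrite /F; case: eqP => [->//|_]; case: ifP => // xS.
    exact: Sk.
  have := lamF e; rewrite /F eqxx => ek; split=> //.
  apply/forall_inP => x xS; have := lamF x; rewrite /F xS.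
  by case: eqP => // xe; rewrite -xe xS in eS.
rewrite (bigD1 e) //= {1}/F eqxx card1 mul1n (bigID (mem S)) /=.
rewrite (eq_bigr (fun=> K - k)) => [|x /andP[/negPf xe xS]]; last first.
  by rewrite /F xe xS cF.
rewrite [X in _ * X * _](eq_bigr (fun=> K)) => [|x /andP[/negPf xe /negPf xS]]; last first.
  by rewrite /F xe xS card_ord.
rewrite !prod_nat_const.
have -> : #|[pred x | x != e & x \in S]| = #|S|.
  apply: eq_card => x; rewrite !inE; case: eqP => // ->.
  by rewrite (negPf eS).
rewrite -mulnA -expnD mulnC; congr (K ^ _ * _).
rewrite -(cardsC (e |: S)) cardsU1 eS add1n addSn addnS addnC; congr (_.+1 + _).
by apply: eq_card => x; rewrite !inE negb_or.
Qed.

(** * Factorizations as edge colourings *)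

Section Factorization.
Variables (n d M : nat) (t : M.-tuple {set {set 'I_n}}).
Hypothesis tP : one_factorization d t.

Lemma card_factor_edge i e : e \in tnth t i -> #|e| = d.
Proof.
move=> ei; case/and3P: tP => _ _ /and3P[/eqP tc _ _].
suff : e \in hyperedges n d by rewrite inE => /eqP.
rewrite -tc; apply/bigcupP; exists (tnth t i) => //.
by rewrite inE mem_tnth.
Qed.

Lemma factor_unique i j e : e \in tnth t i -> e \in tnth t j -> i = j.
Proof.
case/and3P: tP => ut _ /and3P[_ /trivIsetP tI _] ei ej.
apply/eqP; rewrite -(inj_eq (tuple_uniqP _ ut)); apply: contraT => ij.
have dis : [disjoint tnth t i & tnth t j] by apply: tI ij; rewrite inE mem_tnth.
by rewrite (disjointFr dis ei) in ej.
Qed.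

Lemma factor_of_edge (e : {set 'I_n}) : #|e| = d -> exists i, e \in tnth t i.
Proof.
move=> ed; case/and3P: tP => _ _ /and3P[/eqP tc _ _].
have : e \in hyperedges n d by rewrite inE ed.
rewrite -tc => /bigcupP[F]; rewrite inE => /tnthP[i ->] ei.
by exists i.
Qed.

Lemma factor_degree i v : #|[set e in tnth t i | v \in e]| = 1.
Proof.
case/and3P: tP => _ /allP /(_ _ (mem_tnth i t)) /andP[_ /forallP/(_ v)/eqP] //.
Qed.

Lemma factor_edge_unique i v x y :
  x \in tnth t i -> y \in tnth t i -> v \in x -> v \in y -> x = y.
Proof.
move=> xi yi vx vy; have /eqP/cards1P[z zE] := factor_degree i v.
have : x \in [set e in tnth t i | v \in e] by rewrite inE xi.
have : y \in [set e in tnth t i | v \in e] by rewrite inE yi.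
by rewrite zE !inE => /eqP-> /eqP.
Qed.

Definition star i (e : {set 'I_n}) := [set x in tnth t i | ~~ [disjoint x & e]].

(** A 1-factor covers [e] exactly once, so it meets [e] in #|e| distinct edges
    as soon as none of its edges covers two vertices of [e]. *)
Lemma card_star i (e : {set 'I_n}) :
  [forall x in tnth t i, #|x :&: e| <= 1] -> #|star i e| = #|e|.
Proof.
move=> /forall_inP e1.
transitivity (\sum_(x in tnth t i) #|x :&: e|).
  rewrite -sum1_card (eq_bigl (fun x => (x \in tnth t i) && ~~ [disjoint x & e])); last first.
    by move=> x; rewrite inE.
  rewrite big_mkcondr; apply: eq_bigr => x /e1.
  by rewrite -setI_eq0 -cards_eq0; case: (#|x :&: e|) => [|[]].
transitivity (\sum_(x in tnth t i) \sum_(v in e) (v \in x)).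
  apply: eq_bigr => x _; rewrite -sum1_card big_mkcond [RHS]big_mkcond.
  by apply: eq_bigr => v _; rewrite inE; case: (v \in x); case: (v \in e).
rewrite exchange_big /= -sum1_card; apply: eq_bigr => v _.
rewrite -(factor_degree i v) -sum1_card big_mkcond [RHS]big_mkcond.
by apply: eq_bigr => x _; rewrite inE; case: (v \in x); case: (x \in _).
Qed.

(** A factorization is read as a colouring of the edges by the indices of the
    factors. The value is an option so that no default index has to exist; it
    is [None] only outside the hyperedges. *)
Definition color (e : {set 'I_n}) : option 'I_M := [pick i | e \in tnth t i].

Lemma colorE i e : (color e == Some i) = (e \in tnth t i).
Proof.
rewrite /color; case: pickP => [j ej|e0]; last by rewrite e0.
by apply/eqP/idP => [[<-]|/(factor_unique j i e ej)->].
Qed.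

(** The colours for which [card_star] fails are few, since each is the colour
    of an edge meeting [e] twice. The colour of a hyperedge [e] is itself
    among them, because [e] meets itself in [d >= 2] vertices. *)
Lemma card_bad_colors (e : {set 'I_n}) : 2 <= d <= n ->
  #|[set i | [exists x in tnth t i, 1 < #|x :&: e|]]|
     <= 'C(#|e|, 2) * 'C(n - 2, d - 2).
Proof.
move=> d2n; have := card_meet_twice _ e d; rewrite card_ord => /(_ d2n).
apply: leq_trans; rewrite -(card_imset _ Some_inj).
apply: leq_trans (leq_imset_card color _).
apply/subset_leq_card/subsetP => y /imsetP[i]; rewrite inE => /exists_inP[x xi xe] ->.
apply/imsetP; exists x; last by apply/esym/eqP; rewrite colorE.
by rewrite inE xe andbT; apply/eqP; apply: card_factor_edge xi.
Qed.

(** Edges are exposed by increasing label. This overestimates the colours that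
    remain possible for [e] when its turn comes: an edge with the same label as
    [e] is treated as not yet exposed, so that the set depends on the labels
    only and not on how ties are broken. *)
Definition choices K (lam : {ffun {set 'I_n} -> 'I_K}) e :=
  [set i | [forall x in star i e, lam e <= lam x]].

End Factorization.

Arguments star {n M}.
Arguments color {n M}.
Arguments choices {n M} t {K}.

(** If another factorization [g] agrees with [f] so far and gives [e] the colour
    [i], then an edge of colour [i] in [f] that meets [e] and was already exposed
    would have colour [i] in [g] too, and two edges of a 1-factor of [g] would
    meet. *)
Lemma color_exposed n d M (A : {set M.-tuple {set {set 'I_n}}}) K
    (lam : {ffun {set 'I_n} -> 'I_K}) f p e q :
    {in A, forall t, one_factorization d (tval t)} -> f \in A ->
    sort (relpre lam leq) (enum (hyperedges n d)) = p ++ e :: q ->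
  #|[set color g e | g in A & all (fun x => color g x == color f x) p]|
    <= #|choices f lam e|.
Proof.
move=> AP fA sE.
have srt : sorted (relpre lam leq) (p ++ e :: q).
  by rewrite -sE; apply: sort_sorted => x y; apply: leq_total.
have memE x : x \in p ++ e :: q = (#|x| == d).
  by rewrite -sE mem_sort mem_enum inE.
have ed : #|e| = d by apply/eqP; rewrite -memE mem_cat mem_head orbT.
rewrite -[leqRHS](card_imset _ Some_inj).
apply/subset_leq_card/subsetP => y /imsetP[g]; rewrite inE => /andP[gA /allP gf] ->.
have [i ei] := factor_of_edge n d M g (AP _ gA) e ed.
have /eqP -> : color g e == Some i by rewrite (colorE _ _ _ _ (AP _ gA)).
apply: imset_f; rewrite inE; apply/forall_inP => x; rewrite inE => /andP[xi xe].
rewrite leqNgt; apply/negP => lt_xe.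
have xp : x \in p.
  have : x \in p ++ e :: q by rewrite memE (card_factor_edge _ _ _ _ (AP _ fA) _ _ xi).
  rewrite mem_cat inE => /or3P[//|/eqP xE|xq]; first by rewrite xE ltnn in lt_xe.
  move: srt; rewrite sorted_cat_cons => /andP[_ /order_path_min].
  move=> /(_ (rev_trans (fun _ _ _ h1 h2 => leq_trans h2 h1))) /allP/(_ _ xq) /=.
  by rewrite leqNgt lt_xe.
have xgi : x \in tnth g i.
  by rewrite -(colorE _ _ _ _ (AP _ gA)) (eqP (gf _ xp)) (colorE _ _ _ _ (AP _ fA)).
move: xe; rewrite -setI_eq0 => /set0Pn[v]; rewrite inE => /andP[vx ve].
move: lt_xe; rewrite (factor_edge_unique _ _ _ _ (AP _ gA) _ _ _ _ xgi ei vx ve).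
by rewrite ltnn.
Qed.

Lemma color_inj n d M (f g : M.-tuple {set {set 'I_n}}) :
    one_factorization d f -> one_factorization d g ->
  {in hyperedges n d, color f =1 color g} -> f = g.
Proof.
move=> fP gP fg.
have sub t u : one_factorization d (tval t) -> one_factorization d (tval u) ->
    {in hyperedges n d, color t =1 color u} -> forall i, tnth t i \subset tnth u i.
  move=> tP uP tu i; apply/subsetP => e ei.
  rewrite -(colorE _ _ _ _ uP) -tu ?(colorE _ _ _ _ tP) //.
  by rewrite inE (card_factor_edge _ _ _ _ tP _ _ ei).
apply: eq_from_tnth => i; apply/eqP; rewrite eqEsubset sub //= sub //.
by move=> e eh; rewrite fg.
Qed.

(** * Averaging over labels *)

Local Open Scope ring_scope.

Lemma sum_ln_sub (R : realType) (K : nat) :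
  \sum_(k < K) ln (K - k)%:R = ln (K`!)%:R :> R.
Proof.
elim: K => [|K IHK]; first by rewrite big_ord0 fact0 ln1.
by rewrite big_ord_recl /= subn0 factS natrM lnM ?posrE ?ltr0n ?fact_gt0 // IHK.
Qed.

Lemma sumr_constM (R : pzSemiRingType) (I : finType) (P : pred I) (x : R) :
  \sum_(i in P) x = #|P|%:R * x.
Proof. by rewrite sumr_const mulr_natl. Qed.

Section Average.
Variables (R : realType) (n d K : nat).
Hypothesis d2n : (2 <= d <= n)%N.
Hypothesis K_gt0 : (0 < K)%N.

Local Notation M := 'C(n.-1, d.-1).
Local Notation label := {ffun {set 'I_n} -> 'I_K}.
(* A bound on the number of colours having an edge that meets a fixed edge twice. *)
Local Notation bad := ('C(d, 2) * 'C(n - 2, d - 2))%N.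
(* The number of labellings: sums over labellings are tot times expectations. *)
Let tot : R := K%:R ^+ #|{set 'I_n}|.
(* The main term of the expected number of choices for an edge with label k. *)
Let expected (k : nat) : R := M%:R * ((K - k)%:R / K%:R) ^+ d.

Let M_gt0 : 0 < M%:R :> R.
Proof.
by rewrite ltr0n bin_gt0 -!subn1 leq_sub2r //; case/andP: d2n.
Qed.

Let K_gt0R : 0 < K%:R :> R. Proof. by rewrite ltr0n. Qed.

Let expected_gt0 (k : 'I_K) : 0 < expected k.
Proof. by rewrite mulr_gt0 // exprn_gt0 // divr_gt0 // ltr0n subn_gt0. Qed.

Let inv_expected (k : 'I_K) : (expected k)^-1 <= K%:R ^+ d / M%:R.
Proof.
rewrite -[leRHS]invrK lef_pV2 ?posrE ?invr_gt0 ?divr_gt0 ?exprn_gt0 //.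
rewrite invf_div /expected ler_pM2l // -exprVn lerXn2r ?nnegrE ?invr_ge0 ?divr_ge0 //.
by rewrite ler_peMl ?invr_ge0 // ler1n subn_gt0.
Qed.

Lemma sum_label (e : {set 'I_n}) (g : 'I_K -> R) :
  \sum_(lam : label) g (lam e) = tot / K%:R * \sum_k g k.
Proof.
rewrite (partition_big (fun lam : label => lam e) predT) //= mulr_sumr.
apply: eq_bigr => k _.
rewrite (eq_bigr (fun=> g k)) => [|lam /eqP-> //].
rewrite sumr_constM; congr (_ * _).
apply: (mulIf (lt0r_neq0 K_gt0R)); rewrite divfK ?lt0r_neq0 //.
have := card_labels _ K k e set0; rewrite inE => /(_ isT).
rewrite cards0 expn1 expn0 muln1 => /(congr1 (fun m => m%:R : R)).
rewrite natrM natrX /tot => <-; congr (_%:R * _); apply: eq_card => lam.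
rewrite !inE [X in _ && X](_ : _ = true) ?andbT //.
by apply/forall_inP => x; rewrite inE.
Qed.

Variables (t : M.-tuple {set {set 'I_n}}) (e : {set 'I_n}).
Hypothesis tP : one_factorization d t.
Hypothesis ed : #|e| = d.

Lemma choices_gt0 (lam : label) : (0 < #|choices t lam e|)%N.
Proof.
have [i ei] := factor_of_edge n d M t tP e ed.
apply/card_gt0P; exists i; rewrite inE; apply/forall_inP => x.
rewrite inE -setI_eq0 => /andP[xi /set0Pn[v]]; rewrite inE => /andP[vx ve].
by rewrite (factor_edge_unique n d M t tP i v x e xi ei vx ve).
Qed.

(** For a typical colour [i], the [d] edges of colour [i] meeting [e] have labels
    independent of that of [e], so [i] survives with probability
    [((K - k) / K) ^ d] when [e] has label [k]. Atypical colours are bounded by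
    one each. Dividing by [expected] makes every label contribute alike. *)
Lemma sum_choices_le :
  \sum_(lam : label) #|choices t lam e|%:R / expected (lam e)
    <= tot * (1 + bad%:R * (K%:R ^+ d / M%:R)).
Proof.
pose B := [set i : 'I_M | [exists x in tnth t i, (1 < #|x :&: e|)%N]].
pose P i (lam : label) := [forall x in star t i e, (lam e <= lam x)%N].
pose S i : R := \sum_(lam : label | P i lam) (expected (lam e))^-1.
have -> : \sum_(lam : label) #|choices t lam e|%:R / expected (lam e)
    = \sum_i S i.
  rewrite /S (exchange_big_dep predT) //=; apply: eq_bigr => lam _.
  rewrite sumr_constM; congr (_%:R * _).
  by apply: eq_card => i; rewrite !inE unfold_in.
have SB i : S i <= tot * (K%:R ^+ d / M%:R).
  apply: (@le_trans _ _ (\sum_(lam : label) K%:R ^+ d / M%:R)).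
    rewrite /S big_mkcond; apply: ler_sum => lam _; case: ifP => _; first exact: inv_expected.
    by rewrite divr_ge0 // ?exprn_ge0 // ltW.
  by rewrite sumr_constM card_ffun card_ord natrX.
have SG i : i \notin B -> S i = tot / M%:R.
  rewrite inE negb_exists_in => /forall_inP iB.
  have cS : #|star t i e| = d.
    rewrite (card_star n d M t tP) //; apply/forall_inP => x /iB.
    by rewrite -leqNgt.
  have eS : e \notin star t i e.
    apply/negP; rewrite inE => /andP[/iB]; rewrite setIid ed -leqNgt.
    by case/andP: d2n => d2 _; rewrite leqNgt d2.
  rewrite /S (partition_big (fun lam : label => lam e) predT) //=.
  rewrite (eq_bigr (fun=> tot / M%:R / K%:R)) => [|k _]; last first.
    rewrite (eq_bigr (fun=> (expected k)^-1)) => [|lam /andP[_ /eqP->] //].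
    rewrite sumr_constM.
    have -> : #|[pred lam : label | P i lam && (lam e == k)]|%:R
        = tot * (K - k)%:R ^+ d / K%:R ^+ d.+1 :> R.
      have := card_labels _ K k e _ eS; rewrite cS.
      move=> /(congr1 (fun m => m%:R : R)); rewrite !natrM !natrX /tot => <-.
      rewrite mulfK ?expf_neq0 ?lt0r_neq0 //; congr (_%:R).
      apply: eq_card => lam; rewrite !inE [LHS]andbC.
      by case: (lam e =P k) => //= <-.
    rewrite /expected expr_div_n exprS.
    have K0 : K%:R != 0 :> R by rewrite lt0r_neq0.
    have Kk0 : (K - k)%:R != 0 :> R by rewrite pnatr_eq0 subn_eq0 -ltnNge.
    by field; rewrite K0 lt0r_neq0 ?expf_neq0.
  rewrite sumr_constM card_ord mulrC divfK ?lt0r_neq0 //.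
rewrite (bigID (mem B)) /= mulrDr mulr1 addrC; apply: lerD.
  rewrite (eq_bigr _ SG) sumr_constM.
  apply: (@le_trans _ _ (M%:R * (tot / M%:R))).
    apply: ler_wpM2r; first by rewrite divr_ge0 ?exprn_ge0 // ltW.
    by rewrite ler_nat -[X in (_ <= X)%N]card_ord max_card.
  by rewrite mulrC divfK ?lt0r_neq0.
apply: le_trans (ler_sum _ (fun i _ => SB i)) _.
rewrite sumr_constM mulrCA; apply: ler_wpM2l; first exact: exprn_ge0.
apply: ler_wpM2r; first by rewrite divr_ge0 ?exprn_ge0 // ltW.
rewrite ler_nat; have := card_bad_colors n d M t tP e d2n; rewrite ed.
by apply.
Qed.

Lemma sum_ln_expected :
  \sum_(k < K) ln (expected k)
    = K%:R * ln M%:R + d%:R * (ln (K`!)%:R - K%:R * ln K%:R).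
Proof.
rewrite (eq_bigr (fun k : 'I_K => ln M%:R + (d%:R * ln (K - k)%:R - d%:R * ln K%:R))).
  rewrite !big_split /= sumrN -mulr_sumr sum_ln_sub !sumr_const card_ord.
  by rewrite -[ln _ *+ _]mulr_natl -[(_ * _) *+ _]mulr_natl mulrBr [d%:R * (_ * _)]mulrCA.
move=> k _; have Kk : 0 < (K - k)%:R :> R by rewrite ltr0n subn_gt0.
rewrite lnM ?posrE ?exprn_gt0 ?divr_gt0 // lnXn ?divr_gt0 //.
by rewrite ln_div ?posrE // -[_ *+ d]mulr_natl mulrBr.
Qed.

(** The tangent to [ln] is taken at [expected], where it is tight up to the
    contribution of the atypical colours. *)
Lemma sum_ln_choices_le :
  \sum_(lam : label) ln #|choices t lam e|%:R
    <= tot * (ln M%:R + d%:R * (ln (K`!)%:R / K%:R - ln K%:R)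
              + bad%:R * (K%:R ^+ d / M%:R)).
Proof.
apply: (@le_trans _ _ (\sum_(lam : label) (ln (expected (lam e))
    + #|choices t lam e|%:R / expected (lam e) - 1))).
  apply: ler_sum => lam _; apply: ln_le_tangent => //.
  by rewrite ltr0n choices_gt0.
rewrite !big_split /= (sum_label e (fun k : 'I_K => ln (expected k))).
rewrite sum_ln_expected sumr_constM card_ffun card_ord natrX -/tot -addrA.
have K0 : K%:R != 0 :> R by rewrite lt0r_neq0.
apply: le_trans (lerD (lexx _) (lerD sum_choices_le (lexx _))) _.
rewrite le_eqVlt; apply/orP; left; apply/eqP.
by field; rewrite K0 lt0r_neq0.
Qed.

End Average.

(** The entropy bound holds for every labelling and is averaged over all of
    them; only then is each edge equally likely to come early or late. *)
Lemma ln_Phi_le (R : realType) (n d K : nat) :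
    (2 <= d <= n)%N -> (0 < K)%N -> (0 < Phi n d)%N ->
  ln (Phi n d)%:R <= 'C(n, d)%:R *
    (ln 'C(n.-1, d.-1)%:R + d%:R * (ln (K`!)%:R / K%:R - ln K%:R)
     + ('C(d, 2) * 'C(n - 2, d - 2))%:R * (K%:R ^+ d / 'C(n.-1, d.-1)%:R)) :> R.
Proof.
move=> d2n K0; rewrite /Phi; set A := [set s | _] => A0.
have AP : {in A, forall t, one_factorization d (tval t)} by move=> t; rewrite inE.
set Q := (X in _ <= _ * X).
set M := 'C(n.-1, d.-1) in A A0 AP Q *.
pose tot : R := K%:R ^+ #|{set 'I_n}|.
have tot0 : 0 < tot by rewrite exprn_gt0 // ltr0n.
have A0R : 0 < #|A|%:R :> R by rewrite ltr0n.
have lamP (lam : {ffun {set 'I_n} -> 'I_K}) : #|A|%:R * ln #|A|%:R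
    <= \sum_(t in A) \sum_(e in hyperedges n d) ln #|choices t lam e|%:R :> R.
  have := @card_mul_ln_le_choices R _ _ _ color
    (fun t e => #|choices t lam e|)
    (sort (relpre lam leq) (enum (hyperedges n d))) A.
  move=> /(_ _ _) /le_trans; apply.
  - move=> f g fA gA fg; apply: (color_inj n d M f g (AP _ fA) (AP _ gA)) => e ed.
    by apply: fg; rewrite mem_sort mem_enum.
  - by move=> f p e q fA sE; apply: (color_exposed n d M A K lam f p e q AP fA sE).
  apply: ler_sum => t _; rewrite le_eqVlt; apply/orP; left; apply/eqP.
  by rewrite (perm_big _ (permEl (perm_sort _ _))) big_enum.
have cH : #|hyperedges n d| = 'C(n, d) by rewrite card_draws card_ord.
rewrite -cH -(ler_pM2l A0R) -(ler_pM2l tot0).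
have -> : tot * (#|A|%:R * ln #|A|%:R)
    = \sum_(lam : {ffun {set 'I_n} -> 'I_K}) (#|A|%:R * ln #|A|%:R).
  by rewrite sumr_constM card_ffun card_ord natrX.
apply: le_trans (ler_sum _ (fun lam _ => lamP lam)) _.
rewrite exchange_big /= mulrCA -sumr_constM; apply: ler_sum => t tA.
rewrite exchange_big /= mulrCA -sumr_constM; apply: ler_sum => e.
rewrite inE => /eqP ed; exact: sum_ln_choices_le (AP _ tA) ed.
Qed.

(** * Numerical estimates *)

(** The crude Stirling bound [K! <= e * K * (K / e) ^ K]. *)
Lemma ln_fact_le (R : realType) (K : nat) : (0 < K)%N ->
  ln (K`!)%:R + K%:R <= 1 + K.+1%:R * ln K%:R :> R.
Proof.
case: K => // K _; elim: K => [|K IHK].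
  by rewrite (_ : 1`! = 1)%N // ln1 mulr0 addr0 add0r.
have lnK : K.+2%:R * ln K.+1%:R + 1 <= K.+2%:R * ln K.+2%:R :> R.
  have := ln_le_tangent R K.+2%:R K.+1%:R (ltr0Sn _ _) (ltr0Sn _ _).
  move=> /(ler_wpM2l (ler0n R K.+2)).
  rewrite !mulrDr mulrCA divff ?pnatr_eq0 // mulr1 -[K.+2%:R as X in _ + X * -1]natr1.
  lra.
rewrite factS natrM lnM ?posrE ?ltr0n ?fact_gt0 //.
rewrite -[X in _ + X <= _]natr1 -[K.+3%:R]natr1.
lra.
Qed.

(** Squares are taken so that [ln (m ^ 2) <= 2 * m - 2] is small against
    [m ^ 2], which avoids the limit of [ln K / K]. *)
Lemma ln_fact_sqr_le (R : realType) (m : nat) : (0 < m)%N ->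
  ln ((m ^ 2)`!)%:R / (m ^ 2)%:R - ln (m ^ 2)%:R <= -1 + 2 / m%:R :> R.
Proof.
move=> m0; have mR : 0 < m%:R :> R by rewrite ltr0n.
have K0 : 0 < (m ^ 2)%:R :> R by rewrite ltr0n expn_gt0 m0.
have lnK : ln (m ^ 2)%:R <= 2 * m%:R - 2 :> R.
  rewrite natrX lnXn // mulr2n.
  have := ln_le_tangent R 1 m%:R ltr01 mR; rewrite ln1 divr1 add0r; lra.
have := ln_fact_le R (m ^ 2) _; rewrite expn_gt0 m0 => /(_ isT) h.
rewrite lerBlDr ler_pdivrMr // mulrDl mulrDl.
have -> : 2 / m%:R * (m ^ 2)%:R = 2 * m%:R :> R.
  by rewrite natrX; field; rewrite lt0r_neq0.
move: h; rewrite -[X in X * ln _]natr1; lra.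
Qed.

(** The number of atypical colours is of order 1 / n times the number
    'C(n.-1, d.-1) of colours. *)
Lemma mul_bin_pred_bin (n d : nat) : (2 <= d <= n)%N ->
  ('C(d, 2) * 'C(n - 2, d - 2) * n.-1 = 'C(d, 2) * d.-1 * 'C(n.-1, d.-1))%N.
Proof.
case: d n => [|[|d]] [|[|n]] // _.
by rewrite !subSS !subn0 -mulnA [('C(n, d) * _)%N]mulnC (mul_bin_diag n.+1 d) mulnA.
Qed.

Lemma fact_le_expn d : (d`! <= d ^ d.-1)%N.
Proof.
case: d => // d; elim: d => // d IHd.
rewrite factS expnS leq_mul2l /=; apply: leq_trans IHd _.
by case: d => // d; rewrite leq_exp2r.
Qed.

(** The entropy bound has [(d - 1)!] in the place of the [n]-th root of [mu],
    so this comparison is all that has to be known about [mu]. *)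
Lemma root_mu (R : realType) (n d : nat) : (2 <= d)%N -> (0 < n)%N ->
  0 < mu R n d `^ (1 / n%:R) <= (d.-1)`!%:R.
Proof.
move=> d2 n0.
have rootX (x : R) : 0 < x -> (x ^+ n) `^ (1 / n%:R) = x.
  move=> x0; rewrite -powR_mulrn ?ltW // -powRrM mulrCA divff ?mulr1 ?powRr1 ?ltW //.
  by rewrite pnatr_eq0 -lt0n.
rewrite /mu; case: eqP => [->|d2']; first by rewrite powR1 ltr01 lexx.
case: eqP => [->|d3].
  have p0 : 0 < 2 `^ (3 / 2) :> R by rewrite powR_gt0.
  rewrite rootX ?divr_gt0 //= ler_pdivrMr // (_ : 2`! = 2)%N //.
  apply: (@le_trans _ _ (2 `^ 2)).
    by rewrite ler_powR ?ler1n //; lra.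
  by rewrite powR_mulrn // expr2; lra.
have df0 : 0 < d`!%:R :> R by rewrite ltr0n fact_gt0.
have d0 : 0 < d%:R :> R by rewrite ltr0n ltnW.
have p1 : 1 <= d`!%:R `^ (1 / d%:R) :> R.
  apply: (@le_trans _ _ (1 `^ (1 / d%:R))); first by rewrite powR1.
  by rewrite ge0_ler_powR ?nnegrE ?divr_ge0 // ?ler1n ?fact_gt0.
rewrite rootX; last by rewrite !mulr_gt0 ?invr_gt0 ?mulr_gt0 ?exprn_gt0 ?(lt_le_trans _ p1).
rewrite divr_gt0 ?mulr_gt0 ?exprn_gt0 ?(lt_le_trans _ p1) //=.
rewrite ler_pdivrMr ?mulr_gt0 ?exprn_gt0 ?(lt_le_trans _ p1) //.
(* The d-th root of d! is at least 1, so d! * d <= d ^ d suffices. *)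
rewrite mulrA -[leLHS]mulr1; apply: ler_pM => //.
rewrite -!natrX -natrM ler_nat.
have dE : d = d.-1.+1 by rewrite prednK // ltnW.
rewrite expnS expn1 {1}dE factS -dE mulnC [X in (_ <= _ * X)%N](_ : _ = d * d ^ d.-1)%N; last first.
  by rewrite -expnS -dE.
rewrite [leqRHS]mulnCA [leqRHS]mulnA [leqRHS]mulnC leq_mul2r fact_le_expn.
by rewrite orbT.
Qed.

Lemma binM_fact_le n k : ('C(n, k) * k`! <= n ^ k)%N.
Proof.
rewrite bin_ffact; elim: k n => // k IHk [|n]; first by rewrite ffact0n.
rewrite ffactnS expnS leq_mul2l /=; apply: leq_trans (IHk _) _.
by case: k {IHk} => // k; rewrite leq_exp2r.
Qed.

(** * Asymptotics *)

Local Open Scope classical_set_scope.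
Local Open Scope ring_scope.

Lemma powRK (R : realType) (p x : R) : p != 0 -> 0 <= x -> (x `^ p) `^ p^-1 = x.
Proof. by move=> p0 x0; rewrite -powRrM divff // powRr1. Qed.

(** The least nonnegative [eps] that works for each [n] tends to zero once every
    fixed [delta > 0] eventually works. *)
Lemma powR_asymp_bound (R : realType) (a B p : nat -> R) :
    (forall n, (0 < n)%N -> 0 <= a n) -> (forall n, (0 < n)%N -> 0 < B n) ->
    (forall n, (0 < n)%N -> 0 < p n) ->
    (forall delta, 0 < delta ->
       \forall n \near \oo, a n <= ((1 + delta) * B n) `^ p n) ->
  exists eps : nat -> R, (eps n @[n --> \oo] --> (0 : R)) /\
    forall n, (0 < n)%N -> a n <= ((1 + eps n) * B n) `^ p n.
Proof.
move=> a0 B0 p0 aB.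
exists (fun n => Num.max 0 (a n `^ (p n)^-1 / B n - 1)); split.
  apply/cvgrPdist_le => delta delta0; near=> n.
  have n0 : (0 < n)%N by near: n; exact: nbhs_infty_gt.
  rewrite sub0r normrN ger0_norm ?le_max ?lexx // ge_max ltW //=.
  rewrite lerBlDl ler_pdivrMr ?B0 //.
  have dB : 0 <= (1 + delta) * B n by rewrite mulr_ge0 ?addr_ge0 ?(ltW delta0) // ltW ?B0.
  rewrite -[leRHS](powRK _ (p n) _ _ dB) ?lt0r_neq0 ?p0 //.
  apply: ge0_ler_powR; rewrite ?nnegrE ?powR_ge0 ?invr_ge0 ?a0 ?(ltW (p0 _ n0)) //.
  by near: n; exact: aB.
move=> n n0; have pn := p0 n n0.
rewrite -[leLHS](powRK _ (p n)^-1 (a n)) ?a0 ?invr_neq0 ?lt0r_neq0 // invrK.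
have h : a n `^ (p n)^-1 <= (1 + Num.max 0 (a n `^ (p n)^-1 / B n - 1)) * B n.
  by rewrite -ler_pdivrMr ?B0 // -lerBlDl le_max lexx orbT.
apply: ge0_ler_powR; rewrite ?nnegrE ?powR_ge0 ?(ltW pn) //.
exact: le_trans (powR_ge0 _ _) h.
Unshelve. all: end_near. Qed.

Lemma Phi_near_le (R : realType) (d : nat) (delta : R) : (2 <= d)%N -> 0 < delta ->
  \forall n \near \oo, (Phi n d)%:R <=
    ((1 + delta) * (n%:R ^+ (d - 1) / (mu R n d `^ (1 / n%:R) * expR 1 ^+ d)))
      `^ (n%:R ^+ d / d`!%:R).
Proof.
move=> d2 delta0; pose D : R := ln (1 + delta).
have D0 : 0 < D by rewrite ln_gt0 // ltrDl.
(* Half of the slack D pays for the discretization of labels, through the choice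
   of K = m ^ 2; the other half pays for the atypical colours once n is large
   with respect to K. *)
have [m m0 dm] : exists2 m, (0 < m)%N & d%:R * (2 / m%:R) <= D / 2.
  exists (Num.bound (4 * d%:R / D)).+1 => //.
  rewrite mulrA ler_pdivrMr ?ltr0Sn //.
  have := @archi_boundP R (4 * d%:R / D); rewrite ltr_pdivrMr //.
  rewrite divr_ge0 ?mulr_ge0 ?(ltW D0) // => /(_ isT).
  rewrite -[X in _ <= _ * X]natr1; move: D0; lra.
pose K := (m ^ 2)%N; have K0 : (0 < K)%N by rewrite expn_gt0 m0.
pose c : R := ('C(d, 2) * d.-1)%:R * K%:R ^+ d.
near=> n.
have dn : (d <= n)%N by near: n; exact: nbhs_infty_ge.
have d2n : (2 <= d <= n)%N by rewrite d2.
have n0 : (0 < n)%N by rewrite (leq_trans _ dn) // ltnW.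
have nR : 0 < n%:R :> R by rewrite ltr0n.
have n1 : 2 * c / D + 1 <= n%:R by near: n; exact: nbhs_infty_ger.
have n2 : (d.-1)`!%:R * expR d%:R <= n%:R :> R by near: n; exact: nbhs_infty_ger.
have M0 : 0 < 'C(n.-1, d.-1)%:R :> R by rewrite ltr0n bin_gt0 -!subn1 leq_sub2r.
have f0 : 0 < (d.-1)`!%:R :> R by rewrite ltr0n fact_gt0.
have bad_le : ('C(d, 2) * 'C(n - 2, d - 2))%:R * (K%:R ^+ d / 'C(n.-1, d.-1)%:R)
    <= D / 2.
  have np : 0 < n.-1%:R :> R.
    by rewrite ltr0n -subn1 subn_gt0 (leq_trans d2).
  have /(congr1 (fun k => k%:R : R)) := mul_bin_pred_bin n d d2n.
  rewrite natrM [in RHS]natrM => e.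
  rewrite mulrA ler_pdivrMr // -(ler_pM2r np) mulrAC e.
  rewrite [leLHS](_ : _ = c * 'C(n.-1, d.-1)%:R); last by rewrite /c mulrAC.
  rewrite [leRHS]mulrAC ler_pM2r //.
  have nE : n%:R = n.-1%:R + 1 :> R by rewrite natr1 prednK.
  move: n1; rewrite nE lerD2r ler_pdivrMr //; lra.
have ln_M : ln 'C(n.-1, d.-1)%:R <= d.-1%:R * ln n%:R - ln (d.-1)`!%:R :> R.
  rewrite lerBrDr -lnM ?posrE // [_ * ln _]mulr_natl -lnXn // ler_ln ?posrE ?mulr_gt0 ?exprn_gt0 //.
  rewrite -natrM -natrX ler_nat (leq_trans (binM_fact_le _ _)) //.
  by rewrite leq_exp2r ?leq_pred // -subn1 subn_gt0.
have /andP[mu0 mu_le] := root_mu R n d d2 n0.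
set B := (X in (X `^ _)).
have B0 : 0 < B.
  by rewrite !mulr_gt0 ?invr_gt0 ?mulr_gt0 ?exprn_gt0 ?expR_gt0 // addr_gt0.
have lnB : D + d.-1%:R * ln n%:R - ln (d.-1)`!%:R - d%:R <= ln B.
  rewrite /B lnM ?posrE ?addr_gt0 //; last by rewrite divr_gt0 ?mulr_gt0 ?exprn_gt0 ?expR_gt0.
  rewrite -/D ln_div ?posrE ?mulr_gt0 ?exprn_gt0 ?expR_gt0 //.
  rewrite lnM ?posrE ?exprn_gt0 ?expR_gt0 // !lnXn ?expR_gt0 // expRK subn1.
  rewrite -[_ *+ d.-1]mulr_natl.
  have : ln (mu R n d `^ (1 / n%:R)) <= ln (d.-1)`!%:R by rewrite ler_ln ?posrE.
  lra.
(* This lets the exponent 'C(n, d) grow to n ^ d / d!. *)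
have lnB0 : 0 <= ln B.
  apply: le_trans lnB.
  have : ln (d.-1)`!%:R + d%:R <= ln n%:R :> R.
    by rewrite -{1}[d%:R]expRK -lnM ?posrE ?expR_gt0 // ler_ln ?posrE ?mulr_gt0 ?expR_gt0.
  have ln0 : 0 <= ln n%:R :> R by rewrite ln_ge0 // ler1n.
  have : ln n%:R <= d.-1%:R * ln n%:R :> R.
    by rewrite ler_peMl // ler1n -subn1 subn_gt0.
  by move: D0; lra.
case: (posnP (Phi n d)) => [->|P0]; first exact: powR_ge0.
rewrite -ler_ln ?posrE ?powR_gt0 ?ltr0n // ln_powR.
apply: le_trans (ln_Phi_le R n d K d2n K0 P0) _.
apply: (@le_trans _ _ ('C(n, d)%:R * ln B)).
  apply: ler_wpM2l => //.
  have := ler_wpM2l (ler0n R d) (ln_fact_sqr_le R m m0); rewrite -/K.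
  rewrite [d%:R * (-1 + _)]mulrDr mulrN1; lra.
apply: ler_wpM2r => //.
rewrite ler_pdivlMr ?ltr0n ?fact_gt0 // -natrM -natrX ler_nat.
exact: binM_fact_le.
Unshelve. all: end_near. Qed.

Theorem theorem7 (R : realType) (d : nat) (hd : (2 <= d)%N) :
  exists eps : nat -> R,
    (eps n @[n --> \oo] --> (0 : R)) /\
    forall n : nat, (0 < n)%N -> (d %| n)%N ->
      (Phi n d)%:R <=
        ((1 + eps n) * (n%:R ^+ (d - 1)
                        / (mu R n d `^ (1 / n%:R) * expR 1 ^+ d)))
          `^ (n%:R ^+ d / d`!%:R).
Proof.
have [|n n0|n n0|delta delta0|eps [eps0 le_eps]] := @powR_asymp_bound R
  (fun n => (Phi n d)%:R)
  (fun n => n%:R ^+ (d - 1) / (mu R n d `^ (1 / n%:R) * expR 1 ^+ d))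
  (fun n => n%:R ^+ d / d`!%:R).
- by [].
- have /andP[mu0 _] := root_mu R n d hd n0.
  by rewrite divr_gt0 ?mulr_gt0 ?exprn_gt0 ?expR_gt0 ?ltr0n.
- by rewrite divr_gt0 ?exprn_gt0 ?ltr0n ?fact_gt0.
- exact: Phi_near_le.
by exists eps; split=> // n n0 _; exact: le_eps.
Qed.
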